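(* Let $d\ge 1$, $N:=2^{\lfloor (d+1)/2\rfloor}$, $m\ge 0$, and let $A:\mathbb{R}^d\to\mathbb{R}^d$ and $V:\mathbb{R}^d\to\mathbb{C}^{N\times N}$ satisfy the standing assumptions listed in the context. Suppose that $$\|V\psi\|\le \|H_m(A)\psi\|-m\|\psi\|\qquad\text{for every }\psi\in H^1(\mathbb{R}^d;\mathbb{C}^N).$$ Then $\sigma_p(H_m(A,V))\cap(-m,m)=\varnothing$.
   Context: Dirac matrices: $\boldsymbol{\alpha}=(\alpha_1,\dots,\alpha_d)$ and $\beta$ are $N\times N$ Hermitian matrices with $\alpha_j\alpha_k+\alpha_k\alpha_j=2\delta_{jk}\mathbb{I}_N$, $\alpha_j\beta+\beta\alpha_j=0$, $\beta^2=\mathbb{I}_N$ for $j,k\in\{1,\dots,d\}$. $\|\cdot\|$ and $\langle\cdot,\cdot\rangle$ are the norm and scalar product of $L^2(\mathbb{R}^d;\mathbb{C}^N)$. Operators: $\nabla_A:=\nabla-iA$ is the magnetic gradient (components $\partial_j^A=\partial_j-iA_j$), $H_m(A):=-i\boldsymbol{\alpha}\cdot\nabla_A+m\beta=-i\sum_j\alpha_j\partial_j^A+m\beta$, and $H_m(A,V):=H_m(A)+V$. The magnetic field is the matrix-valued function $B_{jk}=\partial_jA_k-\partial_kA_j$ (distributional derivatives). Standing assumptions: $A\in L^2_{loc}(\mathbb{R}^d)$ with $B\in L^2_{loc}(\mathbb{R}^d)$, and $H_m(A)$ is self-adjoint in $L^2(\mathbb{R}^d;\mathbb{C}^N)$ with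 domain $H^1(\mathbb{R}^d;\mathbb{C}^N)$; $V(x)$ is Hermitian for almost every $x$; $V$ is $H_m(A)$-bounded with relative bound less than $1$, i.e. there are constants $a,b>0$, $a<1$, with $\|V\psi\|^2\le a\|H_m(A)\psi\|^2+b\|\psi\|^2$ for all $\psi\in H^1(\mathbb{R}^d;\mathbb{C}^N)$. Hence $H_m(A,V)$ is self-adjoint with domain $H^1(\mathbb{R}^d;\mathbb{C}^N)$. $\sigma_p$ denotes the point spectrum, i.e. the set of all eigenvalues. *)

(* Defs.v *)
From HB Require Import structures.
From mathcomp Require Import all_boot all_order all_algebra.
From mathcomp Require Import all_classical all_reals all_analysis.
From mathcomp Require Import complex.

Set Implicit Arguments.
Unset Strict Implicit.
Unset Printing Implicit Defensive.
Import Order.TTheory GRing.Theory Num.Theory.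
Import numFieldNormedType.Exports.
Local Open Scope classical_set_scope.
Local Open Scope complex_scope.
Local Open Scope ring_scope.

(* R^d is 'rV[R]_d, so as to have the normed-space structure of the library.
   Matrices carry no measurable structure there; as for n.-tuple T, we use the
   sigma-algebra generated by the coordinates, i.e. the Borel sigma-algebra. *)

Definition measure_rV_display : measure_display.
Proof. exact. Qed.

Section measurable_rV.
Context {R : realType} (d : nat).

Let coors : 'I_d -> 'rV[R]_d -> R := fun j x => x ord0 j.

Let rV_set0 : g_sigma_preimage coors set0.
Proof. exact: sigma_algebra0. Qed.

Let rV_setC A : g_sigma_preimage coors A -> g_sigma_preimage coors (~` A).
Proof. exact: sigma_algebraC. Qed.

Let rV_bigcup (F : (set 'rV[R]_d)^nat) :
  (forall i, g_sigma_preimage coors (F i)) ->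
  g_sigma_preimage coors (\bigcup_i (F i)).
Proof. exact: sigma_algebra_bigcup. Qed.

HB.instance Definition _ := @isMeasurable.Build measure_rV_display
  'rV[R]_d (g_sigma_preimage coors) rV_set0 rV_setC rV_bigcup.

End measurable_rV.

Lemma measurable_coord {R : realType} d (j : 'I_d) :
  measurable_fun [set: 'rV[R]_d] (fun x : 'rV[R]_d => x ord0 j).
Proof.
move=> _ Y mY; rewrite setTI; apply: sub_sigma_algebra => /=.
rewrite -bigcup_seq/=; exists j => /=; first by rewrite mem_index_enum.
by exists Y => //; rewrite setTI.
Qed.

Lemma measurable_fun_rVP {R : realType} d1 (T : measurableType d1) d
    (f : T -> 'rV[R]_d) :
  (forall j, measurable_fun [set: T] (fun t => f t ord0 j)) ->
  measurable_fun [set: T] f.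
Proof.
move=> mf _ A mA; rewrite setTI.
pose G := [set B : set 'rV[R]_d | measurable (f @^-1` B)].
suff : (measurable : set (set 'rV[R]_d)) `<=` G by exact.
apply: smallest_sub.
  split => [|B /= GB|F GF]; rewrite /G/=.
  - by rewrite preimage_set0.
  - by rewrite setTD preimage_setC; exact: measurableC.
  - by rewrite preimage_bigcup; exact: bigcupT_measurable.
rewrite -bigcup_seq => B [j _] [C mC <-].
by rewrite /G/= setTI -[X in measurable X]setTI; exact: mf.
Qed.

Definition cons_rV {R : realType} d (p : R * 'rV[R]_d) : 'rV[R]_d.+1 :=
  row_mx (const_mx p.1 : 'rV[R]_1) p.2.

Definition uncons_rV {R : realType} d (x : 'rV[R]_d.+1) : R * 'rV[R]_d :=
  (x ord0 ord0, rsubmx (x : 'rV[R]_(1 + d))).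

Lemma cons_rVK {R : realType} d : cancel (@cons_rV R d) (@uncons_rV R d).
Proof.
case=> a y; rewrite /cons_rV /uncons_rV row_mxKr; congr pair => /=.
have := row_mxEl (const_mx a : 'rV[R]_1) y ord0 ord0; rewrite [RHS]mxE => {2}<-.
by congr (row_mx _ _ _ _); exact/val_inj.
Qed.

Lemma measurable_cons_rV {R : realType} d :
  measurable_fun [set: R * 'rV[R]_d] (@cons_rV R d).
Proof.
apply: measurable_fun_rVP => j; rewrite /cons_rV.
case: (split_ordP (j : 'I_(1 + d))) => k ->.
- rewrite (_ : (fun t => _) = fst); first exact: measurable_fst.
  by apply/funext => t; exact: etrans (row_mxEl _ _ _ _) (mxE _ _ _ _).
- rewrite (_ : (fun t => _) = (fun y : 'rV[R]_d => y ord0 k) \o snd); last first.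
    by apply/funext => t; exact: row_mxEr.
  exact: (measurableT_comp (measurable_coord k) measurable_snd).
Qed.

Lemma measurable_uncons_rV {R : realType} d :
  measurable_fun [set: 'rV[R]_d.+1] (@uncons_rV R d).
Proof.
apply/measurable_fun_pairP; split; first exact: measurable_coord.
apply: measurable_fun_rVP => j /=.
under [X in measurable_fun _ X]eq_fun do rewrite mxE.
exact: measurable_coord.
Qed.


Section cons_measure.
Context {R : realType} (d : nat).
Variable mu : {sigma_finite_measure set 'rV[R]_d -> \bar R}.

Definition cons_measure : set 'rV[R]_d.+1 -> \bar R :=
  pushforward (lebesgue_measure \x mu)%E (@cons_rV R d).

HB.instance Definition _ := Measure.copy cons_measure
  (@measure_function_pushforward__canonical__measure_function_Measure
     _ _ _ _ _ (lebesgue_measure \x mu)%E _ (@measurable_cons_rV R d)).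

Let cons_measure_sigma_finite : sigma_finite setT cons_measure.
Proof.
have /sigma_finiteP[F [TF ndF Foo]] := sigma_finiteT (@lebesgue_measure R).
have /sigma_finiteP[G [TG ndG Goo]] := sigma_finiteT mu.
exists (fun n => @uncons_rV R d @^-1` (F n `*` G n)).
  rewrite -preimage_bigcup (_ : \bigcup_n _ = setT) ?preimage_setT//.
  rewrite -setXTT TF TG predeqE => -[x y]; split.
    by move=> [n _ []/= ? ?]; split; exists n.
  move=> [/= [n _ Fnx] [k _ Gky]]; exists (maxn n k) => //; split.
  - by move: x Fnx; exact/subsetPset/ndF/leq_maxl.
  - by move: y Gky; exact/subsetPset/ndG/leq_maxr.
move=> n; have [[mF Fn] [mG Gn]] := (Foo n, Goo n); split.
  rewrite -[X in measurable X]setTI; apply: measurable_uncons_rV => //.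
  exact: measurableX.
rewrite /cons_measure /pushforward -comp_preimage.
rewrite (_ : @uncons_rV R d \o @cons_rV R d = id); last first.
  by apply/funext => p; exact: cons_rVK.
by rewrite preimage_id product_measure1E// lte_mul_pinfty// ge0_fin_numE.
Qed.

HB.instance Definition _ := @Measure_isSigmaFinite.Build _ _ _ cons_measure
  cons_measure_sigma_finite.

End cons_measure.

Fixpoint lebesgue_rV (R : realType) (d : nat) :
    {sigma_finite_measure set 'rV[R]_d -> \bar R} :=
  if d is d'.+1 then cons_measure (lebesgue_rV R d') else dirac (0 : 'rV[R]_0).

Section function_spaces.
Variables (R : realType) (d N : nat).
Local Notation C := R[i].
Local Notation mu := (lebesgue_rV R d).

(* Elements of L^2(R^d; C^N) are represented by functions, and equality in
   L^2 by almost everywhere equality. *)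
Definition spinor := 'rV[R]_d -> 'cV[C]_N.

Definition ae_eq_spinor (phi psi : spinor) : Prop :=
  {ae mu, forall x, phi x = psi x}.

Definition cmeasurable (f : 'rV[R]_d -> C) : Prop :=
  measurable_fun setT (fun x => complex.Re (f x)) /\
  measurable_fun setT (fun x => complex.Im (f x)).

Definition cintegral (f : 'rV[R]_d -> C) : C :=
  (\int[mu]_x complex.Re (f x))%R +i* (\int[mu]_x complex.Im (f x))%R.

Definition cvnorm (v : 'cV[C]_N) : R :=
  Num.sqrt (\sum_(k < N) Normc.normc (v k ord0) ^+ 2).

Definition norm2 (psi : spinor) : \bar R :=
  Lnorm mu 2%:E (fun x => (cvnorm (psi x))%:E).

Definition L2 : set spinor :=
  [set psi : spinor | (forall k, cmeasurable (fun x => psi x k ord0)) /\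
             (norm2 psi < +oo)%E].

Definition inner (phi psi : spinor) : C :=
  cintegral (fun x => \sum_(k < N) ((phi x k ord0)^*)%C * psi x k ord0).

Definition L2loc (f : 'rV[R]_d -> R) : Prop :=
  measurable_fun setT f /\
  forall K : set 'rV[R]_d, compact K ->
    (\int[mu]_(x in K) (f x ^+ 2)%:E < +oo)%E.

Definition partial (j : 'I_d) (f : 'rV[R]_d -> R) : 'rV[R]_d -> R :=
  fun x => 'D_(delta_mx ord0 j) (f : 'rV[R]_d -> R^o) x.

Definition iter_partial (s : seq 'I_d) (f : 'rV[R]_d -> R) : 'rV[R]_d -> R :=
  foldr partial f s.

Definition smooth (f : 'rV[R]_d -> R) : Prop :=
  forall s : seq 'I_d,
    continuous (iter_partial s f) /\
    forall j x, derivable (iter_partial s f : 'rV[R]_d -> R^o) x (delta_mx ord0 j).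

(* Real-valued test functions: by linearity they define the same distributional
   derivatives as complex-valued ones. *)
Definition test_function (f : 'rV[R]_d -> R) : Prop :=
  smooth f /\ compact (closure [set x | f x != 0]).

Definition weak_partial (j : 'I_d) (psi w : spinor) : Prop :=
  forall f, test_function f -> forall k,
    cintegral (fun x => psi x k ord0 * (partial j f x)%:C) =
    - cintegral (fun x => w x k ord0 * (f x)%:C).

Definition H1 : set spinor :=
  [set psi : spinor | L2 psi /\ forall j, exists2 w, L2 w & weak_partial j psi w].

(* The weak derivative in L^2 (unique up to a.e. equality) when there is one,
   and 0 otherwise. *)
Definition Dw (j : 'I_d) (psi : spinor) : spinor :=
  xget (fun _ => 0) [set w | L2 w /\ weak_partial j psi w].

End function_spaces.

(* An unbounded operator in L^2(R^d; C^N) is given by its domain D and an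
   action T, of which only the values on D matter. *)
Section unbounded_operators.
Variables (R : realType) (d N : nat).
Local Notation C := R[i].
Local Notation spinor := (spinor R d N).
Variables (D : set spinor) (T : spinor -> spinor).

Definition densely_defined : Prop :=
  forall psi, L2 psi -> forall e : R, 0 < e ->
    exists2 phi, D phi & (norm2 (fun x => psi x - phi x)%R < e%:E)%E.

(* phi is in the domain of the adjoint of (D, T), which maps it to eta. *)
Definition adjoint_graph (phi eta : spinor) : Prop :=
  [/\ L2 phi, L2 eta &
      forall psi, D psi -> inner (T psi) phi = inner psi eta].

Definition self_adjoint : Prop :=
  [/\ forall psi, D psi -> L2 psi /\ L2 (T psi),
      densely_defined &
      forall phi eta, adjoint_graph phi eta <->
        [/\ D phi, L2 eta & ae_eq_spinor (T phi) eta]].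

Definition point_spectrum : set C :=
  [set z | exists psi, [/\ D psi, ~ ae_eq_spinor psi (fun _ => 0) &
                          ae_eq_spinor (T psi) (fun x => z *: psi x)]].

End unbounded_operators.

Section dirac_operator.
Variables (R : realType) (d N : nat).
Local Notation C := R[i].
Variables (alpha : 'I_d -> 'M[C]_N) (beta : 'M[C]_N).

Definition dirac_matrices : Prop :=
  [/\ forall j, alpha j \is hermsymmx,
      beta \is hermsymmx,
      forall j k, alpha j *m alpha k + alpha k *m alpha j
                  = (2 * (j == k)%:R)%:M,
      forall j, alpha j *m beta + beta *m alpha j = 0 &
      beta *m beta = 1%:M].

Variables (m : R) (A : 'rV[R]_d -> 'rV[R]_d) (V : 'rV[R]_d -> 'M[C]_N).

Definition magnetic_partial (j : 'I_d) (psi : spinor R d N) : spinor R d N :=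
  fun x => Dw j psi x - ('i%C * (A x ord0 j)%:C) *: psi x.

Definition dirac_op (psi : spinor R d N) : spinor R d N :=
  fun x => - 'i%C *: (\sum_(j < d) alpha j *m magnetic_partial j psi x)
           + m%:C *: (beta *m psi x).

Definition mulV (psi : spinor R d N) : spinor R d N := fun x => V x *m psi x.

Definition dirac_op_pot (psi : spinor R d N) : spinor R d N :=
  fun x => dirac_op psi x + mulV psi x.

Definition hermitian_potential : Prop :=
  (forall k l, cmeasurable (fun x => V x k l)) /\
  {ae lebesgue_rV R d, forall x, V x \is hermsymmx}.

Definition dirac_bounded : Prop :=
  exists a b : R, [/\ 0 < a, a < 1, 0 < b &
    forall psi, H1 psi ->
      (norm2 (mulV psi) ^+ 2 <=
       a%:E * norm2 (dirac_op psi) ^+ 2 + b%:E * norm2 psi ^+ 2)%E].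

(* B_{jk} = d_j A_k - d_k A_j in the sense of distributions. *)
Definition magnetic_field (B : 'rV[R]_d -> 'M[R]_d) : Prop :=
  forall j k f, test_function f ->
    (\int[lebesgue_rV R d]_x (B x j k * f x))%R =
    - (\int[lebesgue_rV R d]_x
         (A x ord0 k * partial j f x - A x ord0 j * partial k f x))%R.

Definition magnetic_potential : Prop :=
  (forall j, L2loc (fun x => A x ord0 j)) /\
  exists2 B, magnetic_field B & forall j k, L2loc (fun x => B x j k).

End dirac_operator.

Definition spinor_dim (d : nat) : nat := (2 ^ (d.+1)./2)%N.

(* Main.v *)
(* If (H + V) psi = t psi with |t| < m, then H psi = t psi - V psi, so that
   ||H psi|| <= |t| ||psi|| + ||V psi|| by Minkowski's inequality.  Together with
   ||V psi|| <= ||H psi|| - m ||psi|| and the finiteness of these norms this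
   gives (m - |t|) ||psi|| <= 0, hence psi = 0. *)
Require Import Defs.
From mathcomp Require Import all_boot all_order all_algebra.
From mathcomp Require Import all_classical all_reals all_analysis.
From mathcomp Require Import measurable_realfun complex lra.
Import Order.TTheory GRing.Theory Num.Theory.
Import numFieldNormedType.Exports.
Local Open Scope classical_set_scope.
Local Open Scope complex_scope.
Local Open Scope ring_scope.

(** Finite Minkowski inequality. The separate majorized family [h] makes it fit complex entries,
    where [h] is the modulus of a sum and [f], [g] are the moduli of its terms. *)
Lemma sqrt_sum_sqr_leD (R : rcfType) (I : Type) (r : seq I) (f g h : I -> R) :
  (forall i, 0 <= h i) -> (forall i, h i <= f i + g i) ->
  Num.sqrt (\sum_(i <- r) h i ^+ 2) <=
  Num.sqrt (\sum_(i <- r) f i ^+ 2) + Num.sqrt (\sum_(i <- r) g i ^+ 2).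
Proof.
move=> h0 hfg; elim: r => [|i r IH]; first by rewrite !big_nil sqrtr0 addr0.
(* Peeling off one term reduces the claim to the triangle inequality in C. *)
have sumE (k : I -> R) : Num.sqrt (\sum_(j <- i :: r) k j ^+ 2) =
    Normc.normc (k i +i* Num.sqrt (\sum_(j <- r) k j ^+ 2)).
  by rewrite big_cons /= sqr_sqrtr// sumr_ge0// => j _; exact: sqr_ge0.
rewrite !sumE; apply: le_trans (le_normcD _ _) => /=.
rewrite ler_sqrt; last by rewrite addr_ge0// sqr_ge0.
(* Squaring preserves the order only between nonnegative numbers; [f i] and [g i] have no sign of
   their own, but their sum dominates [h i]. *)
have fg0 := le_trans (h0 i) (hfg i).
by rewrite lerD// lerXn2r// ?nnegrE// ?sqrtr_ge0// addr_ge0 ?sqrtr_ge0.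
Qed.

Lemma cvnormD (R : realType) (N : nat) (u v : 'cV[R[i]]_N) :
  cvnorm (u + v) <= cvnorm u + cvnorm v.
Proof.
apply: sqrt_sum_sqr_leD => k; first by case: ((u + v) k ord0) => a b; exact: sqrtr_ge0.
by rewrite mxE; exact: le_normcD.
Qed.

Lemma cvnormZ (R : realType) (N : nat) (c : R) (v : 'cV[R[i]]_N) :
  cvnorm (c%:C *: v) = `|c| * cvnorm v.
Proof.
rewrite /cvnorm -sqrtr_sqr -sqrtrM ?sqr_ge0//; congr Num.sqrt.
rewrite mulr_sumr; apply: eq_bigr => k _.
by rewrite mxE Normc.normcM exprMn /= expr0n addr0 sqrtr_sqr real_normK// num_real.
Qed.

Lemma cvnorm_eq0 (R : realType) (N : nat) (v : 'cV[R[i]]_N) :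
  cvnorm v = 0 -> v = 0.
Proof.
move=> /eqP; rewrite sqrtr_eq0 => v0; apply/matrixP => k j.
have /eqP : \sum_(k < N) Normc.normc (v k ord0) ^+ 2 = 0.
  by apply/eqP; rewrite eq_le v0 sumr_ge0// => l _; exact: sqr_ge0.
rewrite psumr_eq0 => [|l _]; last exact: sqr_ge0.
move=> /allP /(_ k (mem_index_enum k)); rewrite sqrf_eq0 => /eqP/Normc.eq0_normc.
by rewrite (ord1 j) mxE.
Qed.

Section spinor_norm.
Context {R : realType} {d N : nat}.
Local Notation mu := (lebesgue_rV R d).
Implicit Types (f g : 'rV[R]_d -> R[i]) (phi psi : spinor R d N).

(** The measurability half of [L2], split off because the norm of [mulV V psi] is estimated before
    it is known to be finite. *)
Definition measurable_spinor psi := forall k, cmeasurable (fun x => psi x k ord0).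

Lemma cmeasurable_cst (c : R[i]) : cmeasurable (fun _ : 'rV[R]_d => c).
Proof. by split; exact: measurable_cst. Qed.

Lemma cmeasurableD f g :
  cmeasurable f -> cmeasurable g -> cmeasurable (fun x => f x + g x).
Proof.
move=> [fr fi] [gr gi]; split.
- rewrite (_ : (fun _ => _) =
    (fun x => complex.Re (f x)) \+ (fun x => complex.Re (g x))).
    exact: measurable_funD.
  by apply/funext => x /=; case: (f x); case: (g x).
- rewrite (_ : (fun _ => _) =
    (fun x => complex.Im (f x)) \+ (fun x => complex.Im (g x))).
    exact: measurable_funD.
  by apply/funext => x /=; case: (f x); case: (g x).
Qed.

Lemma cmeasurableM f g :
  cmeasurable f -> cmeasurable g -> cmeasurable (fun x => f x * g x).
Proof.
move=> [fr fi] [gr gi]; split.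
- rewrite (_ : (fun _ => _) = (fun x => complex.Re (f x) * complex.Re (g x)
    - complex.Im (f x) * complex.Im (g x))).
    by apply: measurable_funB; exact: measurable_funM.
  by apply/funext => x /=; case: (f x); case: (g x).
- rewrite (_ : (fun _ => _) = (fun x => complex.Re (f x) * complex.Im (g x)
    + complex.Im (f x) * complex.Re (g x))).
    by apply: measurable_funD; exact: measurable_funM.
  by apply/funext => x /=; case: (f x); case: (g x).
Qed.

Lemma cmeasurable_sum (I : Type) (r : seq I) (f : I -> 'rV[R]_d -> R[i]) :
  (forall i, cmeasurable (f i)) -> cmeasurable (fun x => \sum_(i <- r) f i x).
Proof.
move=> mf; elim: r => [|i r IH].
  under [X in cmeasurable X]eq_fun do rewrite big_nil.
  exact: cmeasurable_cst.
under [X in cmeasurable X]eq_fun do rewrite big_cons.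
exact: cmeasurableD.
Qed.

Lemma measurable_spinorD phi psi : measurable_spinor phi ->
  measurable_spinor psi -> measurable_spinor (fun x => phi x + psi x).
Proof.
move=> mphi mpsi k; under [X in cmeasurable X]eq_fun do rewrite mxE.
exact: cmeasurableD.
Qed.

Lemma measurable_spinorZ (c : R[i]) psi :
  measurable_spinor psi -> measurable_spinor (fun x => c *: psi x).
Proof.
move=> mpsi k; under [X in cmeasurable X]eq_fun do rewrite mxE.
by apply: cmeasurableM => //; exact: cmeasurable_cst.
Qed.

Lemma measurable_mulV (V : 'rV[R]_d -> 'M[R[i]]_N) psi :
  (forall k l, cmeasurable (fun x => V x k l)) ->
  measurable_spinor psi -> measurable_spinor (mulV V psi).
Proof.
move=> mV mpsi k; under [X in cmeasurable X]eq_fun do rewrite mxE.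
by apply: cmeasurable_sum => l; exact: cmeasurableM.
Qed.

Lemma measurable_sqrt : measurable_fun setT (@Num.sqrt R).
Proof. by apply: continuous_measurable_fun; exact: sqrt_continuous. Qed.

Lemma measurable_cvnorm psi :
  measurable_spinor psi -> measurable_fun setT (fun x => cvnorm (psi x)).
Proof.
move=> mpsi; apply: (measurableT_comp measurable_sqrt).
apply: measurable_sum => k; apply: measurable_funX.
have [mr mi] := mpsi k.
(* [normc] is defined by matching on the complex number; going through [Re] and [Im] turns it into a
   composition of measurable maps. *)
rewrite (_ : (fun _ => _) = (fun x => Num.sqrt
  (complex.Re (psi x k ord0) ^+ 2 + complex.Im (psi x k ord0) ^+ 2))).
  apply: (measurableT_comp measurable_sqrt).
  by apply: measurable_funD; exact: measurable_funX.
by apply/funext => x; case: (psi x k ord0).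
Qed.

Lemma norm2_ge0 psi : (0 <= norm2 psi)%E.
Proof. exact: Lnorm_ge0. Qed.

Lemma Lnorm2_ae_le (f g : 'rV[R]_d -> R) :
  measurable_fun setT f -> measurable_fun setT g ->
  {ae mu, forall x, `|f x| <= `|g x|} ->
  ('N[mu]_2%:E[EFin \o f] <= 'N[mu]_2%:E[EFin \o g])%E.
Proof.
move=> mf mg fg; rewrite unlock /=.
have mpow (h : 'rV[R]_d -> R) : measurable_fun setT h ->
    measurable_fun setT (fun x => `|(h x)%:E| `^ 2)%E.
  move=> mh; apply/measurable_EFinP.
  apply: (measurableT_comp (measurable_powR 2)).
  exact: measurableT_comp.
(* The square root is monotone on [0, +oo], so it remains to compare the integrals of the squares,
   finite or not. *)
apply: gt0_ler_poweR.
- by rewrite invr_ge0.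
- by rewrite in_itv/= integral_ge0// leey.
- by rewrite in_itv/= integral_ge0// leey.
apply: ae_ge0_le_integral => //; [exact: mpow|exact: mpow|].
apply: filterS fg => x fgx _ /=.
by rewrite lee_fin ge0_ler_powR// nnegrE.
Qed.

(** Pointwise, the triangle inequality in C^N bounds [cvnorm (chi x)] by a sum of two real
    functions, to which the scalar Minkowski inequality applies. Almost everywhere equality is all
    that an eigenvalue equation in L^2 provides. *)
Lemma norm2_ae_leD chi phi psi :
  measurable_spinor chi -> measurable_spinor phi -> measurable_spinor psi ->
  ae_eq_spinor chi (fun x => phi x + psi x) ->
  (norm2 chi <= norm2 phi + norm2 psi)%E.
Proof.
move=> mchi mphi mpsi chiE.
have mp := measurable_cvnorm _ mphi; have ms := measurable_cvnorm _ mpsi.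
apply: le_trans (eminkowski _ mp ms _) => //; last by rewrite lee_fin ler1n.
apply: Lnorm2_ae_le; [exact: measurable_cvnorm|exact: measurable_funD|].
apply: filterS chiE => x ->.
by rewrite !ger0_norm ?addr_ge0 ?sqrtr_ge0// cvnormD.
Qed.

(** Real scalars suffice: the ones that occur are t and -1. An infinite norm is allowed, with 0 *
    +oo = 0. *)
Lemma norm2Z (c : R) psi : measurable_spinor psi ->
  norm2 (fun x => c%:C *: psi x) = (`|c|%:E * norm2 psi)%E.
Proof.
move=> /measurable_cvnorm mpsi; rewrite /norm2 unlock /=.
under eq_integral do rewrite cvnormZ normrM normr_id powRM// EFinM.
have mpow : measurable_fun setT (fun x => (`|cvnorm (psi x)| `^ 2)%:E).
  apply/measurable_EFinP; apply: (measurableT_comp (measurable_powR 2)).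
  exact: measurableT_comp.
rewrite ge0_integralZl ?lee_fin ?powR_ge0//.
rewrite poweRM ?integral_ge0// ?lee_fin ?powR_ge0//.
by rewrite poweR_EFin -powRrM mulfV// powRr1.
Qed.

Lemma norm2_eq0 psi :
  measurable_spinor psi -> norm2 psi = 0%E -> ae_eq_spinor psi (fun _ => 0).
Proof.
move=> mpsi psi0.
have mcv : measurable_fun setT (fun x => (cvnorm (psi x))%:E).
  by apply/measurable_EFinP; exact: measurable_cvnorm.
have lt02 : (0%R < 2%:E :> \bar R)%E by rewrite lte_fin.
apply: filterS (Lnorm_eq0_eq0 mcv lt02 psi0) => x /(_ I)[].
exact: cvnorm_eq0.
Qed.

End spinor_norm.

Theorem theorem1p1 (R : realType) (d : nat) (hd : (1 <= d)%N)
  (alpha : 'I_d -> 'M[R[i]]_(spinor_dim d)) (beta : 'M[R[i]]_(spinor_dim d))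
  (hdirac : dirac_matrices alpha beta)
  (m : R) (hm : 0 <= m)
  (A : 'rV[R]_d -> 'rV[R]_d) (hA : magnetic_potential A)
  (hsa : self_adjoint (@H1 R d (spinor_dim d)) (dirac_op alpha beta m A))
  (V : 'rV[R]_d -> 'M[R[i]]_(spinor_dim d)) (hV : hermitian_potential V)
  (hbd : dirac_bounded alpha beta m A V)
  (hVH : forall psi : spinor R d (spinor_dim d), H1 psi ->
    (norm2 (mulV V psi) <=
     norm2 (dirac_op alpha beta m A psi) - m%:E * norm2 psi)%E) :
  point_spectrum (@H1 R d (spinor_dim d)) (dirac_op_pot alpha beta m A V)
    `&` [set t%:C | t in `]- m, m[%classic] = set0.
Proof.
apply/seteqP; split=> // z [[psi [Hpsi psi_neq0 eig]] [t tm zE]].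
(* The strict inequality makes m - |t| a positive factor, to be cancelled at the end. *)
have tltm : `|t| < m by move: tm; rewrite /= in_itv/= ltr_norml.
have [Lpsi LHpsi] : L2 psi /\ L2 (dirac_op alpha beta m A psi).
  by case: hsa => /(_ _ Hpsi).
apply: psi_neq0; apply: norm2_eq0; first exact: (proj1 Lpsi).
have mVpsi : measurable_spinor (mulV V psi).
  by apply: measurable_mulV; [case: hV|case: Lpsi].
have HleV : (norm2 (dirac_op alpha beta m A psi) <=
    `|t|%:E * norm2 psi + norm2 (mulV V psi))%E.
  rewrite -norm2Z; last by case: Lpsi.
  (* The inserted factor 1 = |-1| turns the last norm into that of -V psi, so that H psi = t psi +
     (-1) V psi is a sum as in [norm2_ae_leD]. *)
  rewrite -[norm2 (mulV V psi)]mul1e -(@normrN1 R) -norm2Z//.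
  apply: norm2_ae_leD; first exact: (proj1 LHpsi).
  - by apply: measurable_spinorZ; case: Lpsi.
  - exact: measurable_spinorZ.
  apply: filterS eig => x; rewrite -zE => <-.
  by rewrite /dirac_op_pot rmorphN1 scaleN1r addrK.
have := hVH _ Hpsi; move: HleV (norm2_ge0 psi) (norm2_ge0 (mulV V psi)).
case: Lpsi LHpsi => _ + [_]; have := norm2_ge0 (dirac_op alpha beta m A psi).
(* All three norms are real numbers: those of psi and H psi by membership in [L2], and then that of
   V psi because [hVH] bounds it by a real number. The rest is arithmetic in R. *)
case: (norm2 psi) => [n| |]//; case: (norm2 (dirac_op _ _ _ _ _)) => [h| |]//.
case: (norm2 (mulV V psi)) => [v| |]//= _ _ _.
rewrite -!EFinM -EFinD -EFinB !lee_fin => hv n0 _ vh.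
have : (m - `|t|) * n <= 0 by rewrite mulrBl; lra.
rewrite pmulr_rle0 ?subr_gt0// => nle0.
by congr EFin; apply/eqP; rewrite eq_le nle0.
Qed.
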